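(* Let $S\in\mathbf{H}(\mathcal{T})$ be a Schur multiplier and let $\mathbf{H}(S)$ be the associated de Branges–Rovnyak space. Let the operators $$V_j=\begin{pmatrix}A_j&B_j\\ C&D\end{pmatrix}:\begin{pmatrix}\mathbf{H}(S)\\ \mathcal{C}_2\end{pmatrix}\longrightarrow\begin{pmatrix}\mathbf{H}(S)\\ \mathcal{C}_2\end{pmatrix},\quad 1\le j\le q,$$ be defined by $$A_jF=(F-F^\wedge(0))\alpha_j,\quad B_jd=(S-S^\wedge(0))d\alpha_j,\quad CF=F^\wedge(0),\quad Dd=S^\wedge(0)d\qquad(F\in\mathbf{H}(S),\ d\in\mathcal{C}_2).$$ Let $U\in\mathbf{H}_2(\mathcal{T})$, $U=\sum_{w\in\mathcal{F}_q}w^*U_{[w]}$ with $U_{[w]}\in\mathcal{C}_2$, and let $Y=SU\in\mathbf{H}_2(\mathcal{T})$. Then the coefficients $Y_{[w]}\in\mathcal{C}_2$ of the expansion $Y=\sum_{w\in\mathcal{F}_q}w^*Y_{[w]}$ satisfy the recurrent relations $$\begin{cases}X_\emptyset=0,&\\ X_{w\alpha_j}=A_jX_w+B_jU_w& (w\in\mathcal{F}_q,\ 1\le j\le q),\\ Y_{[w]}=w\,(CX_v+DU_v)\,v^*& \text{for all } w,v\in\mathcal{F}_q\text{ with }|v|=|w|,\end{cases}$$ where $$U_w:=\sum_{v\in\mathcal{F}_q:\,|v|=|w|}v^*U_{[v]}w .$$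
   Context: Tree setting. Let $q\ge 1$ be an integer and $\mathcal{T}$ a homogeneous tree of order $q$, i.e. an acyclic, undirected, connected graph such that every node belongs to exactly $q+1$ edges. An infinite path from $t$ is a sequence of nodes $(t_0=t,t_1,t_2,\dots)$ with consecutive nodes joined by an edge and $t_{k+1}\neq t_k\neq t_{k+2}$ for all $k$. Two infinite paths $(t_k),(s_k)$ are equivalent if there are $m,n\ge 0$ with $t_{m+k}=s_{n+k}$ for all $k\ge 0$; equivalence classes are boundary points. Fix a boundary point $\infty_{\mathcal{T}}$; each node $t$ has a unique representative path of $\infty_{\mathcal{T}}$ starting at $t$. For nodes $t,s$ with representative paths $(t_k),(s_k)$ of $\infty_{\mathcal{T}}$, take the minimal $m,n$ with $t_{m+k}=s_{n+k}$ for all $k\ge0$, and set $s\wedge t:=t_m=s_n$, $\operatorname{dist}(s,t):=m+n$. Write $s\preceq t$ if $\operatorname{dist}(s,s\wedge t)\le\operatorname{dist}(t,s\wedge t)$ and $s\asymp t$ if equality holds. Fix maps (primitive shifts) $\alpha_1,\dots,\alpha_q:\mathcal{T}\to\mathcal{T}$, acting on the right, with $\{t\alpha_1,\dots,t\alpha_q\}=\{s: t\preceq s,\ \operatorname{dist}(t,s)=1\}$ for every $t$. Let $\mathcal{F}_q$ be the free semigroup with unit $\emptyset$ generated by $\alpha_1,\dots,\alpha_q$; $|\emptyset|=0$, $|\alpha_{i_1}\cdots\alpha_{i_n}|=n$; $w\in\mathcal{F}_q$ acts on nodes by $t\mapsto tw$. Operators. $\ell_2(\mathcal{T})$ is the Hilbert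 space of square-summable functions $f:\mathcal{T}\to\mathbb{C}$ with standard basis $\chi_t$; $\mathbf{X}(\mathcal{T})$ is the algebra of bounded linear operators on it, with operator norm $\|\cdot\|$. Each $w\in\mathcal{F}_q$ is also regarded as the operator $(wf)(t)=f(tw)$ in $\mathbf{X}(\mathcal{T})$, with adjoint $w^*$. $S\in\mathbf{X}(\mathcal{T})$ is causal if for every node $s$ and $f\in\ell_2(\mathcal{T})$ with $f(t)=0$ for all $t\preceq s$, one has $(Sf)(t)=0$ for all $t\preceq s$. $\mathbf{H}(\mathcal{T})$ is the algebra of causal operators and $\mathcal{C}=\{S\in\mathbf{X}(\mathcal{T}): S,S^*\in\mathbf{H}(\mathcal{T})\}$ is the algebra of constants. Each $S\in\mathbf{H}(\mathcal{T})$ has coefficients $S_{[w]}\in\mathcal{C}$ ($w\in\mathcal{F}_q$) given by $(S_{[w]}\chi_t)(s)=(S\chi_t)(sw)$ if $t\asymp s$ and $0$ otherwise, and $S=\sum_{w\in\mathcal{F}_q}w^*S_{[w]}$ pointwise absolutely (for every $f,t$ the series evaluated at $f$ and $t$ converges absolutely to $(Sf)(t)$). These are the coefficients meant in all expansions. Moreover $S^\wedge(0):=S_{[\emptyset]}$ for $S\in\mathbf{H}(\mathcal{T})$ (value of the point evaluation at $0$). Hilbert–Schmidt spaces. $\mathbf{H}_2(\mathcal{T})=\{F\in\mathbf{H}(\mathcal{T}):\|F\|_2^2:=\operatorname{trace}(F^*F)<\infty\}$ with $\langle F,G\rangle_2=\operatorname{trace}(G^*F)$, a Hilbert space; $\mathcal{C}_2=\mathcal{C}\cap\mathbf{H}_2(\mathcal{T})$.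 If $F\in\mathbf{H}_2(\mathcal{T})$ then all $F_{[w]}\in\mathcal{C}_2$. For $S\in\mathbf{H}(\mathcal{T})$, $M_S$ is the operator $F\mapsto SF$ on $\mathbf{H}_2(\mathcal{T})$. Schur multipliers. A Schur multiplier is $S\in\mathbf{H}(\mathcal{T})$ with $\|S\|\le1$. With $\mathcal{B}_S=I-M_SM_S^*$ on $\mathbf{H}_2(\mathcal{T})$ and $\pi_S$ the orthogonal projection of $\mathbf{H}_2(\mathcal{T})$ onto $\ker\mathcal{B}_S$, the de Branges–Rovnyak space associated with $S$ is the Hilbert space $\mathbf{H}(S)=\sqrt{\mathcal{B}_S}\,\mathbf{H}_2(\mathcal{T})$ with norm $\|\sqrt{\mathcal{B}_S}F\|_{\mathbf{H}(S)}=\|(I-\pi_S)F\|_2$. The formulas for $A_j,B_j,C,D$ do define bounded operators $V_j$ on $\mathbf{H}(S)\oplus\mathcal{C}_2$; the first two relations define $X_w\in\mathbf{H}(S)$ recursively, and $U_w\in\mathcal{C}_2$. *)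

(* Defs.v *)
From HB Require Import structures.
From mathcomp Require Import all_boot all_order all_algebra.
From mathcomp Require Import all_classical all_reals all_analysis.
From mathcomp Require Import complex ring lra.
From mathcomp.analysis.showcase Require summability.
Set Implicit Arguments.
Unset Strict Implicit.
Unset Printing Implicit Defensive.
Import Order.TTheory GRing.Theory Num.Theory.
Import numFieldNormedType.Exports.
Local Open Scope classical_set_scope.
Local Open Scope ring_scope.

Local Notation normc := ComplexField.Normc.normc.

Section Ell2.
Context {R : realType} {T : choiceType}.
Local Notation C := (R[i]).

(* C^o is R[i] seen as a module over itself, so that T -> C^o is an lmodType. *)
Definition ell2_sqnorm (f : T -> C^o) : \bar R :=
  \esum_(t in [set: T]) (normc (f t) ^+ 2)%:E.

Definition ell2_pred : {pred (T -> C^o)} := fun f => (ell2_sqnorm f < +oo)%E.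

Lemma ell2_sqnorm_ge0 f : (0 <= ell2_sqnorm f)%E.
Proof. by apply: esum_ge0 => t _; rewrite lee_fin sqr_ge0. Qed.

Lemma ell2_sqnorm0 : ell2_sqnorm 0 = 0%E.
Proof.
rewrite /ell2_sqnorm esum1// => t _.
by rewrite (ComplexField.Normc.normc0 R) expr0n.
Qed.

Lemma ell2_sqnormD f g :
  (ell2_sqnorm (f + g)%R <= (ell2_sqnorm f + ell2_sqnorm f) +
                            (ell2_sqnorm g + ell2_sqnorm g))%E.
Proof.
have ge0 (h : T -> C^o) i : [set: T] i -> (0 <= (normc (h i) ^+ 2)%:E :> \bar R)%E.
  by move=> _; rewrite lee_fin sqr_ge0.
have ge0' (h : T -> C^o) i : [set: T] i ->
    (0 <= (normc (h i) ^+ 2)%:E + (normc (h i) ^+ 2)%:E :> \bar R)%E.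
  by move=> Ti; rewrite adde_ge0 ?ge0.
rewrite /ell2_sqnorm -!esumD; do ?[exact: ge0|exact: ge0'].
apply: le_esum => t _; rewrite -!EFinD lee_fin.
have := le_normcD (f t) (g t).
have -> : normc (f t + g t) = normc ((f + g) t) by [].
set a := normc (f t); set b := normc (g t); set c := normc _ => cab.
have a0 : 0 <= a by rewrite /a; case: (f t) => ? ?; exact: sqrtr_ge0.
have b0 : 0 <= b by rewrite /b; case: (g t) => ? ?; exact: sqrtr_ge0.
have c0 : 0 <= c by rewrite /c; case: ((f + g) t) => ? ?; exact: sqrtr_ge0.
apply: (@le_trans _ _ ((a + b) ^+ 2)); first by rewrite lerXn2r// nnegrE addr_ge0.
by have := sqr_ge0 (a - b); nra.
Qed.

Lemma ell2_sqnormZ (k : C) f :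
  ell2_sqnorm (k *: f) = ((normc k ^+ 2)%:E * ell2_sqnorm f)%E.
Proof.
pose X := [set (\sum_(t \in A) (normc (f t) ^+ 2)%:E)%E | A in fsets [set: T]].
have X0 : X != set0 by apply/set0P; eexists; exists set0 => //; split.
rewrite /ell2_sqnorm /esum -(ereal_supZl X0 (sqr_ge0 _)).
congr ereal_sup; apply/seteqP; split => [_ [A [finA AT] <-]|_ [_ [A [finA AT] <-] <-]].
  exists (\sum_(x \in A) (normc (f x) ^+ 2)%:E)%E; first by exists A.
  rewrite !fsbig_finite//= !sumEFin -EFinM mulr_sumr; congr EFin.
  by apply: eq_bigr => t _; rewrite -exprMn -ComplexField.Normc.normcM.
exists A => //.
rewrite !fsbig_finite//= !sumEFin -EFinM mulr_sumr; congr EFin.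
by apply: eq_bigr => t _; rewrite -exprMn -ComplexField.Normc.normcM.
Qed.

Lemma ell2_submod_closed : submod_closed ell2_pred.
Proof.
split; first by rewrite /in_mem/= /ell2_pred ell2_sqnorm0 ltry.
move=> k f g; rewrite /in_mem/= /ell2_pred => fy gy.
apply: le_lt_trans (ell2_sqnormD _ _) _.
have kfy : (ell2_sqnorm (k *: f) < +oo)%E.
  rewrite ell2_sqnormZ -ge0_fin_numE ?mule_ge0 ?lee_fin ?sqr_ge0 ?ell2_sqnorm_ge0//.
  by rewrite fin_numM// ge0_fin_numE ?ell2_sqnorm_ge0.
by rewrite !lte_add_pinfty.
Qed.
HB.instance Definition _ :=
  GRing.isSubmodClosed.Build C (T -> C^o) ell2_pred ell2_submod_closed.

End Ell2.
Arguments ell2_pred R T : clear implicits.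

Record ell2 (R : realType) (T : choiceType) := Ell2 {
  ell2_fun :> T -> R[i]^o ;
  _ : ell2_fun \in ell2_pred R T }.
HB.instance Definition _ R T := [isSub for @ell2_fun R T].
HB.instance Definition _ R T := [Choice of ell2 R T by <:].
HB.instance Definition _ (R : realType) (T : choiceType) :=
  [SubChoice_isSubLmodule of ell2 R T by <:].

Section Ell2Theory.
Context {R : realType} {T : choiceType}.
Local Notation C := (R[i]).
Implicit Types f g : ell2 R T.

(* Unordered sum of a complex family: limit over the net of finite subsets. *)
Definition csum (x : T -> C) : C := summability.sum (x : T -> C^o).

Definition dotp f g : C := csum (fun t => f t * (g t)^*%C).

Definition ell2_norm f : R := Num.sqrt (fine (ell2_sqnorm f)).

Lemma chi_subproof (t : T) :
  (fun s => (s == t)%:R : C^o) \in ell2_pred R T.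
Proof.
rewrite /in_mem/= /ell2_pred /ell2_sqnorm.
rewrite (esumID [set t]); last by move=> s _; rewrite lee_fin sqr_ge0.
rewrite !setTI esum_set1 ?lee_fin ?sqr_ge0// esum1 ?adde0 ?ltry//.
move=> s /= /eqP/negPf ->.
by rewrite (ComplexField.Normc.normc0 R) expr0n.
Qed.
Definition chi (t : T) : ell2 R T := Ell2 (chi_subproof t).

Lemma ell2_fin_num f : ell2_sqnorm f \is a fin_num.
Proof. by rewrite ge0_fin_numE ?ell2_sqnorm_ge0//; exact: (valP f). Qed.

Lemma ell2_norm_ge0 f : 0 <= ell2_norm f.
Proof. exact: sqrtr_ge0. Qed.

Lemma ell2_norm_sqr f : ell2_norm f ^+ 2 = fine (ell2_sqnorm f).
Proof. by rewrite sqr_sqrtr// fine_ge0// ell2_sqnorm_ge0. Qed.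

Lemma ell2_norm0 : ell2_norm (0 : ell2 R T) = 0.
Proof. by rewrite /ell2_norm ell2_sqnorm0 sqrtr0. Qed.

Lemma ell2_normZ (k : C) f : ell2_norm (k *: f) = normc k * ell2_norm f.
Proof.
have k0 : 0 <= normc k by case: k => ? ?; exact: sqrtr_ge0.
rewrite /ell2_norm (_ : ell2_sqnorm _ = ell2_sqnorm (k *: (f : T -> C^o)))//.
rewrite ell2_sqnormZ fineM ?ell2_fin_num//= sqrtrM ?sqr_ge0//.
by rewrite sqrtr_sqr ger0_norm.
Qed.

Lemma ell2_normD2 f g : ell2_norm (f + g) <= 2 * (ell2_norm f + ell2_norm g).
Proof.
rewrite -(@ler_pXn2r _ 2)// ?nnegrE ?mulr_ge0 ?addr_ge0 ?ell2_norm_ge0//.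
have : ell2_norm (f + g) ^+ 2 <= ell2_norm f ^+ 2 + ell2_norm f ^+ 2 +
    (ell2_norm g ^+ 2 + ell2_norm g ^+ 2).
  rewrite !ell2_norm_sqr -lee_fin !EFinD !fineK ?ell2_fin_num//.
  exact: ell2_sqnormD.
have := ell2_norm_ge0 f; have := ell2_norm_ge0 g.
move: (ell2_norm f) (ell2_norm g) (ell2_norm _) => a b c b0 a0 /le_trans; apply.
by nra.
Qed.

Definition bop_pred : {pred (ell2 R T -> ell2 R T)} := fun S =>
  `[< (forall (k : C) f g, S (k *: f + g) = k *: S f + S g) /\
      (exists M : R, forall f, ell2_norm (S f) <= M * ell2_norm f) >].

Lemma bop_bound_pos (S : ell2 R T -> ell2 R T) :
  (exists M : R, forall f, ell2_norm (S f) <= M * ell2_norm f) ->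
  exists2 M : R, 0 <= M & forall f, ell2_norm (S f) <= M * ell2_norm f.
Proof.
move=> [M SM]; exists `|M| => // f.
by apply: le_trans (SM f) _; rewrite ler_wpM2r ?ell2_norm_ge0// ler_norm.
Qed.

Lemma bop_submod_closed : submod_closed bop_pred.
Proof.
split=> [|k S S'].
  apply/asboolP; split=> [k f g|]; first by rewrite scaler0 addr0.
  by exists 0 => f; rewrite ell2_norm0 mul0r.
move=> /asboolP[SL /bop_bound_pos[M M0 SM]].
move=> /asboolP[SL' /bop_bound_pos[M' M'0 SM']].
apply/asboolP; split=> [l f g|].
  rewrite (_ : (k *: S + S') _ = k *: S (l *: f + g) + S' (l *: f + g))//.
  rewrite SL SL' (_ : (k *: S + S') f = k *: S f + S' f)//.
  rewrite (_ : (k *: S + S') g = k *: S g + S' g)//.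
  by rewrite !scalerDr !scalerA mulrC addrACA.
exists (2 * (normc k * M + M')) => f.
apply: le_trans (ell2_normD2 _ _) _.
rewrite -mulrA ler_pM2l// mulrDl lerD//.
have k0 : 0 <= normc k by case: k => ? ?; exact: sqrtr_ge0.
by rewrite ell2_normZ -mulrA ler_wpM2l.
Qed.
HB.instance Definition _ :=
  GRing.isSubmodClosed.Build C (ell2 R T -> ell2 R T) bop_pred bop_submod_closed.

End Ell2Theory.
Arguments bop_pred R T : clear implicits.

Record bop (R : realType) (T : choiceType) := Bop {
  bop_fun :> ell2 R T -> ell2 R T ;
  _ : bop_fun \in bop_pred R T }.
HB.instance Definition _ R T := [isSub for @bop_fun R T].
HB.instance Definition _ R T := [Choice of bop R T by <:].
HB.instance Definition _ (R : realType) (T : choiceType) :=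
  [SubChoice_isSubLmodule of bop R T by <:].

Section BopRing.
Context {R : realType} {T : choiceType}.
Implicit Types F G H : bop R T.

Lemma bop_linear F (k : R[i]) f g : F (k *: f + g) = k *: F f + F g.
Proof. by case/asboolP: (valP F) => /(_ k f g). Qed.

Lemma bop_one_subproof : (id : ell2 R T -> ell2 R T) \in bop_pred R T.
Proof.
apply/asboolP; split; first by [].
by exists 1 => f; rewrite mul1r.
Qed.
Definition bop_one : bop R T := Bop bop_one_subproof.

Lemma bop_mul_subproof F G : (F \o G : ell2 R T -> ell2 R T) \in bop_pred R T.
Proof.
apply/asboolP; split=> [k f g /=|]; first by rewrite !bop_linear.
case/asboolP: (valP F) => _ /bop_bound_pos[M M0 FM].
case/asboolP: (valP G) => _ /bop_bound_pos[N N0 GN].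
exists (M * N) => f; apply: (le_trans (FM (G f))).
by rewrite -mulrA; apply: ler_wpM2l => //; exact: GN.
Qed.
Definition bop_mul F G : bop R T := Bop (bop_mul_subproof F G).

Lemma bop_mulA : associative bop_mul.
Proof. by move=> F G H; apply/val_inj. Qed.
Lemma bop_mul1 : left_id bop_one bop_mul.
Proof. by move=> F; apply/val_inj. Qed.
Lemma bop_1mul : right_id bop_one bop_mul.
Proof. by move=> F; apply/val_inj. Qed.
Lemma bop_mulDl : left_distributive bop_mul +%R.
Proof. by move=> F G H; apply/val_inj. Qed.
Lemma bop_mulDr : right_distributive bop_mul +%R.
Proof.
move=> F G H; apply/val_inj/funext => f /=.
by have := bop_linear F 1 (G f) (H f); rewrite !scale1r.
Qed.
HB.instance Definition _ := GRing.Zmodule_isPzRing.Build (bop R T)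
  bop_mulA bop_mul1 bop_1mul bop_mulDl bop_mulDr.

(* Here and below xget selects the object with the given characteristic
   property, which exists and is unique; the default value is never used. *)
Definition badj F : bop R T :=
  xget 0 [set G : bop R T | forall f g, dotp (F f) g = dotp f (G g)].

Definition opnorm F : R :=
  sup [set ell2_norm (F f) | f in [set f | ell2_norm f <= 1]].

Definition trace F : R[i] := csum (fun t => dotp (F (chi t)) (chi t)).

(* trace (F^* F) as an extended real: the diagonal entries of F^* F are
   nonnegative reals. *)
Definition hs_sqnorm F : \bar R :=
  \esum_(t in [set: T]) (complex.Re (dotp ((badj F * F) (chi t)) (chi t)))%:E.

Definition hs_norm F : R := Num.sqrt (fine (hs_sqnorm F)).

Definition hs_dotp F G : R[i] := trace (badj G * F).

End BopRing.

Section Tree.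
Variable T : choiceType.

Definition homogeneous_tree (q : nat) (e : rel T) : Prop :=
  [/\ symmetric e,
      irreflexive e,
      (forall x y : T, exists2 p, path e x p & last x p = y),
      (forall c : seq T, ucycle e c -> (size c <= 2)%N) &
      (forall x : T, exists2 N : seq T,
         uniq N /\ size N = q.+1 & forall y, e x y = (y \in N))].

Definition infinite_path (e : rel T) (p : nat -> T) : Prop :=
  forall k, e (p k) (p k.+1) /\ p k <> p k.+2.

Definition path_equiv (p s : nat -> T) : Prop :=
  exists m n, forall k, p (m + k)%N = s (n + k)%N.

Definition boundary_point (e : rel T) (xi : set (nat -> T)) : Prop :=
  exists2 p, infinite_path e p &
    xi = [set s | infinite_path e s /\ path_equiv p s].

Variable xi : set (nat -> T).

Definition repr_path (t : T) : nat -> T :=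
  xget (fun=> t) [set p | xi p /\ p 0%N = t].

Definition merge_at (t s : T) (mn : nat * nat) : Prop :=
  forall k, repr_path t (mn.1 + k)%N = repr_path s (mn.2 + k)%N.

Definition merge_index (t s : T) : nat * nat :=
  xget (0%N, 0%N) [set mn | merge_at t s mn /\
    forall mn', merge_at t s mn' -> (mn.1 <= mn'.1)%N /\ (mn.2 <= mn'.2)%N].

Definition meet_node (s t : T) : T := repr_path t (merge_index t s).1.

Definition dist (s t : T) : nat :=
  ((merge_index t s).1 + (merge_index t s).2)%N.

Definition prec (s t : T) : bool :=
  (dist s (meet_node s t) <= dist t (meet_node s t))%N.

Definition asymp (s t : T) : bool :=
  dist s (meet_node s t) == dist t (meet_node s t).

End Tree.

Record shiftTree (q : nat) := ShiftTree {
  node :> choiceType ;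
  edge : rel node ;
  edge_tree : homogeneous_tree q edge ;
  infty : set (nat -> node) ;
  infty_boundary : boundary_point edge infty ;
  alpha : 'I_q -> node -> node ;
  alphaP : forall t : node,
    range (fun i => alpha i t) = [set s | prec infty t s /\ dist infty t s = 1%N]
}.
Arguments edge {q} s.
Arguments infty {q} s.
Arguments alpha {q} s.

Section TreeOperators.
Context {R : realType} {q : nat} {T : shiftTree q}.
Local Notation "s ⪯ t" := (prec (infty T) s t) (at level 70).
Local Notation "s ≍ t" := (asymp (infty T) s t) (at level 70).
(* The free semigroup on alpha_1, ..., alpha_q: product is concatenation, so
   w alpha_j is rcons w j, and |w| is size w. *)
Local Notation word := (seq 'I_q).
Implicit Types (w : word) (S F G K : bop R T).

Definition act (t : T) w : T := foldl (fun s i => alpha T i s) t w.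

Definition shift_op w : bop R T :=
  xget 0 [set W : bop R T | forall (f : ell2 R T) (t : T), W f t = f (act t w)].

Definition causal S : Prop := forall (s : T) (f : ell2 R T),
  (forall t : T, t ⪯ s -> f t = 0) -> forall t : T, t ⪯ s -> S f t = 0.

Definition constant S : Prop := causal S /\ causal (badj S).

Definition coef S w : bop R T :=
  xget 0 [set K : bop R T | forall t s : T,
    K (chi t) s = if t ≍ s then S (chi t) (act s w) else 0].

Definition eval0 S : bop R T := coef S [::].

Definition schur_multiplier S : Prop := causal S /\ opnorm S <= 1.

Definition H2 : set (bop R T) := [set F | causal F /\ (hs_sqnorm F < +oo)%E].

Definition C2 : set (bop R T) := [set F | constant F /\ H2 F].

(* Operators on H2 are represented by maps on bop, of which only the
   restriction to H2 is meaningful (and determined, for mulop_adj and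
   sqrtB below). *)
Definition bounded_on_H2 (N : bop R T -> bop R T) : Prop :=
  [/\ (forall F, H2 F -> H2 (N F)),
      (forall (k : R[i]) F G, H2 F -> H2 G -> N (k *: F + G) = k *: N F + N G) &
      (exists M : R, forall F, H2 F -> hs_norm (N F) <= M * hs_norm F)].

Definition mulop S : bop R T -> bop R T := fun F => S * F.

Definition mulop_adj S : bop R T -> bop R T :=
  xget (fun=> 0) [set N | bounded_on_H2 N /\
    forall F G, H2 F -> H2 G -> hs_dotp (mulop S F) G = hs_dotp F (N G)].

Definition defect S : bop R T -> bop R T := fun F => F - mulop S (mulop_adj S F).

Definition sqrtB S : bop R T -> bop R T :=
  xget (fun=> 0) [set N | [/\ bounded_on_H2 N,
    (forall F, H2 F -> 0 <= hs_dotp (N F) F) &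
    (forall F, H2 F -> N (N F) = defect S F)]].

Definition kerB S : set (bop R T) := [set F | H2 F /\ defect S F = 0].

Definition projkerB S F : bop R T :=
  xget 0 [set P | kerB S P /\ forall K, kerB S K -> hs_dotp (F - P) K = 0].

(* The de Branges-Rovnyak space H(S), as a set of operators. *)
Definition HS S : set (bop R T) := [set sqrtB S F | F in H2].

(* The norm does not depend on the choice of the preimage F of G. *)
Definition HS_norm S G : R :=
  let F := xget 0 [set F | H2 F /\ sqrtB S F = G] in hs_norm (F - projkerB S F).

Definition bounded_block S (A : HS S -> HS S) (B : C2 -> HS S)
    (C : HS S -> C2) (D : C2 -> C2) : Prop :=
  exists M : R, forall (F : HS S) (d : C2),
    HS_norm S (val (A F) + val (B d)) ^+ 2 + hs_norm (val (C F) + val (D d)) ^+ 2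
    <= M * (HS_norm S (val F) ^+ 2 + hs_norm (val d) ^+ 2).

End TreeOperators.
Arguments H2 R {q} T.
Arguments C2 R {q} T.

(* Main.v *)
Require Import Defs.
From HB Require Import structures.
From mathcomp Require Import all_boot all_order all_algebra finmap.
From mathcomp Require Import all_classical all_reals all_analysis.
From mathcomp Require Import complex zify.
From mathcomp.analysis.showcase Require summability.
Import Order.TTheory GRing.Theory Num.Theory.
Import numFieldNormedType.Exports.
Local Open Scope classical_set_scope.
Local Open Scope ring_scope.
Set Implicit Arguments.
Unset Strict Implicit.
Unset Printing Implicit Defensive.

(** Give every node its level, the signed generation number in the genealogy
    whose common ancestor is the fixed boundary point.  Causal operators map
    functions supported on one level to functions supported on that level and
    those below it, and a shift [w] only moves levels by [|w|].  So the theorem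
    is a statement about the diagonals [diag n F] of an operator, where
    [diag n F] keeps the entries of [F] from each level to the [n]-th one
    below.

    Every node has exactly one ancestor [n] levels up, from which exactly one
    word of length [n] leads back to it ([act_inj2], [act_surj]).  Hence
    [w w^* = 1] ([shift_opK]), the projections [v^* v] with [|v| = n] add up to
    [1] ([sum_badj_shift_op]), the coefficients are [F_[w] = w (diag n F)] for
    [n = |w|] ([coef_diag]), and [U_w = (diag n U) w] ([sum_shifted_coef]).

    Write [U_<n] for the sum of [diag k U] over [k < n], and [Y_<n] likewise.
    By induction on [w], the state is
<<
      X_w = (S U_<n - Y_<n) w    with  n = |w|.
>>
    It is what [S] makes of the part of the input read so far, minus the output
    already produced.  Indeed [X_w + S U_w = (S U_<(n+1) - Y_<n) w].  As [S] is
    causal, the part of [U] beyond the [n]-th diagonal does not contribute to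
    the [n]-th diagonal of [S U = Y] ([diag_mul_truncate]); therefore the value
    at [0] of [X_w + S U_w], which is [C X_w + D U_w], equals [(diag n Y) w].
    Removing it and multiplying by [alpha_j] gives the state at [w alpha_j].
    Finally [w (diag n Y) v v^* = w (diag n Y) = Y_[w]] whenever [|v| = |w|].

    The analytic part is that the objects specified by their characteristic
    properties exist as bounded operators and are unique: the diagonals
    ([blockdiag_exists]), the coefficients ([eq_bop_chi]) and the adjoints of
    the shifts ([badj_comp]). *)

(** * Levels of the tree *)

(** A shortest repetition in a walk without backtracking would be a simple cycle
    of length at least three. *)
Lemma reduced_walk_inj (T : choiceType) (q : nat) (e : rel T) (x : nat -> T)
    (N : nat) :
    homogeneous_tree q e ->
    (forall k, (k < N)%N -> e (x k) (x k.+1)) ->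
    (forall k, (k.+1 < N)%N -> x k <> x k.+2) ->
  forall i j, (i < j <= N)%N -> x i <> x j.
Proof.
case=> _ eI _ eA _ xe xr.
suff H : forall d i, (0 < d)%N -> (i + d <= N)%N -> x i <> x (i + d)%N.
  move=> i j /andP[ij jN]; have := H (j - i)%N i; rewrite subnKC ?(ltnW ij)//.
  by apply=> //; rewrite subn_gt0.
elim/ltn_ind => -[//|d] IH i _ idN xid.
have xd a b : (i <= a < b)%N -> (b < i + d.+1)%N -> x a <> x b.
  move=> iab bid; have := IH (b - a)%N _ a; rewrite subnKC; last lia.
  by apply; lia.
have pth m a : (a + m <= N)%N -> path e (x a) [seq x k | k <- iota a.+1 m].
  elim: m a => //= m IHm a amN; rewrite xe; last lia.
  by apply: IHm; lia.
have : ucycle e [seq x k | k <- iota i d.+1].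
  apply/andP; split.
    have -> : cycle e [seq x k | k <- iota i d.+1] =
        path e (x i) (rcons [seq x k | k <- iota i.+1 d] (x i)) by [].
    rewrite {2}xid -map_rcons.
    have -> : rcons (iota i.+1 d) (i + d.+1)%N = iota i.+1 d.+1.
      by rewrite -[d.+1 in RHS]addn1 iotaD cats1 addSnnS.
    exact: pth.
  rewrite map_inj_in_uniq ?iota_uniq// => a b; rewrite !mem_iota => aP bP xab.
  apply/eqP; rewrite eqn_leq; apply/andP.
  split; rewrite leqNgt; apply/negP => ab.
    by apply: (xd b a) => //; lia.
  by apply: (xd a b) => //; lia.
move/eA; rewrite size_map size_iota.
case: d IH idN xid xd => [|[|//]] _ idN xid _ _.
  by have := xe i; rewrite -addn1 -xid eI => /(_ ltac:(lia)).
by apply: (xr i); [lia|rewrite xid addn2].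
Qed.

Section Horocycles.
Variables (q : nat) (T : shiftTree q).
Let e := edge T.
Let xi := infty T.
Let eT : homogeneous_tree q e := @edge_tree q T.
Implicit Types (s t : T) (p r : nat -> T) (m n : nat).

Lemma infinite_path_inj p : infinite_path e p -> injective p.
Proof.
move=> pP i j pij; have H a b : (a < b)%N -> p a <> p b.
  move=> ab; apply: (@reduced_walk_inj _ _ _ p b eT) => [k _|k _|].
  - by have [] := pP k.
  - by have [] := pP k.
  - by rewrite ab leqnn.
by case: (ltngtP i j) => // ij; [have := H _ _ ij|have := H _ _ ij; rewrite pij].
Qed.

Lemma path_equiv_sym p r : path_equiv p r -> path_equiv r p.
Proof. by move=> [m [n H]]; exists n, m => k; rewrite H. Qed.

Lemma path_equiv_trans p r p' :
  path_equiv p r -> path_equiv r p' -> path_equiv p p'.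
Proof.
move=> [m [n H]] [m' [n' H']]; exists (m + m')%N, (n' + n)%N => k.
rewrite -addnA H -addnA -H' !addnA; congr r; lia.
Qed.

Lemma infty_shift p k : xi p -> xi (fun i => p (k + i)%N).
Proof.
have [p0 _ xiE] := @infty_boundary q T; rewrite /xi xiE => -[pP p0p]; split.
  by move=> i; rewrite !addnS; exact: pP.
by apply: path_equiv_trans p0p _; exists k, 0%N.
Qed.

Lemma infty_cons p t : xi p -> e t (p 0%N) -> t <> p 1%N ->
  xi (fun i => if i is i'.+1 then p i' else t).
Proof.
have [p0 _ xiE] := @infty_boundary q T; rewrite /xi xiE => -[pP p0p] et tp.
by split; [case=> [|i] //; exact: pP|apply: path_equiv_trans p0p _; exists 0%N, 1%N].
Qed.

Lemma infty_infinite p : xi p -> infinite_path e p.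
Proof. by have [p0 _ xiE] := @infty_boundary q T; rewrite /xi xiE => -[]. Qed.

Lemma infty_equiv p r : xi p -> xi r -> path_equiv p r.
Proof.
have [p0 _ xiE] := @infty_boundary q T; rewrite /xi xiE => -[_ pP] [_ rP].
exact: path_equiv_trans (path_equiv_sym pP) rP.
Qed.

(** Connectedness reduces this to neighbours: a ray from [t] gives one from each
    neighbour of [t], by dropping its first node or by adding one. *)
Lemma representative_exists t : exists2 p, xi p & p 0%N = t.
Proof.
have [p0 p0i xiE] := @infty_boundary q T.
have [eS _ eC _ _] := eT.
have [w pw <-] := eC (p0 0%N) t.
suff H : forall s, (exists2 p, xi p & p 0%N = s) -> path e s w ->
    exists2 p, xi p & p 0%N = last s w.
  apply: (H (p0 0%N)) => //; exists p0 => //.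
  by rewrite /xi xiE; split=> //; exists 0%N, 0%N.
elim: {pw} w => //= s' w IH s [p pxi ps] /andP[ess' pw]; apply: IH => //.
have [->|/eqP s'p] := eqVneq s' (p 1%N).
  by exists (fun i => p (1 + i)%N) => //; exact: infty_shift.
exists (fun i => if i is i'.+1 then p i' else s') => //.
by apply: infty_cons => //; rewrite eS ps.
Qed.

(** At a first index where two rays of the same boundary point part, one could
    walk back along one ray and forth along the other without backtracking;
    since the rays merge again, this reduced walk would repeat a node. *)
Lemma representative_unique p r : xi p -> xi r -> p 0%N = r 0%N -> p = r.
Proof.
move=> pxi rxi pr0; have [m [n pr]] := infty_equiv pxi rxi.
have pP := infty_infinite pxi; have rP := infty_infinite rxi.
have [eS _ _ _ _] := eT.
suff H : forall k, p k = r k /\ p k.+1 = r k.+1 by apply/funext => k; case: (H k).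
suff H : forall k, p k = r k -> p k.+1 = r k.+1.
  by elim=> [|k [_ IH]]; split=> //; apply: H.
move=> d pd; apply: contrapT => pd1.
(* the walk r_(d+b), ..., r_d = p_d, ..., p_(d+a), whose ends coincide *)
pose a := (m + d.+1)%N; pose b := (n + d.+1)%N.
pose x k := if (k <= b)%N then r (d + (b - k))%N else p (d + (k - b))%N.
have xb : x 0%N = x (b + a)%N.
  rewrite /x leq0n; case: leqP => [|_]; first lia.
  rewrite subn0 addKn /a /b.
  have -> : (d + (m + d.+1) = m + (d + d.+1))%N by lia.
  by rewrite pr; congr r; lia.
apply: (@reduced_walk_inj _ _ _ x (b + a)%N eT _ _ 0%N (b + a)%N) xb => [k kN|k kN|].
- rewrite /x; case: (ltngtP k b) => kb; [| |].
  + have -> : (b - k = (b - k.+1).+1)%N by lia.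
    by rewrite eS addnS; have [] := rP (d + (b - k.+1))%N.
  + have -> : (k.+1 - b = (k - b).+1)%N by lia.
    by rewrite addnS; have [] := pP (d + (k - b))%N.
  + rewrite kb subnn subSn// subnn addn0 -pd addn1.
    by have [] := pP d.
- rewrite /x; case: (ltngtP k.+1 b) => kb.
  + have -> : (k <= b)%N by lia.
    have -> : (b - k = (b - k.+2).+2)%N by lia.
    by rewrite !addnS; apply: nesym; have [] := rP (d + (b - k.+2))%N.
  + have -> : (k.+2 - b = (k - b).+2)%N by lia.
    case: (ltngtP k b) => kb'; [lia| |].
      by rewrite !addnS; have [] := pP (d + (k - b))%N.
    by rewrite kb' subnn addn0 -pd addn2; have [] := pP d.
  + have -> : (k <= b)%N by lia.
    have -> : (k.+2 - b = 1)%N by lia.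
    have -> : (b - k = 1)%N by lia.
    by rewrite addn1 => /esym.
- by rewrite /a; lia.
Qed.

Lemma repr_pathP t : xi (repr_path xi t) /\ repr_path xi t 0%N = t.
Proof.
have [p pxi pt] := representative_exists t.
by apply: (@xgetPex _ (fun=> t) [set p | xi p /\ p 0%N = t]); exists p.
Qed.

Lemma repr_path_unique p : xi p -> repr_path xi (p 0%N) = p.
Proof.
by move=> pxi; have [rxi r0] := repr_pathP (p 0%N); exact: representative_unique.
Qed.

Definition parent t : T := repr_path xi t 1%N.

Lemma repr_pathE t k : repr_path xi t k = iter k parent t.
Proof.
have [rxi r0] := repr_pathP t.
elim: k => [//|k /= <-]; rewrite /parent.
have := repr_path_unique (infty_shift k rxi); rewrite addn0 => ->.
by rewrite addn1.
Qed.

Lemma iter_parent_inj t m n : iter m parent t = iter n parent t -> m = n.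
Proof.
rewrite -!repr_pathE; have [rxi _] := repr_pathP t.
exact: (infinite_path_inj (infty_infinite rxi)).
Qed.

Lemma edge_parent t : e t (parent t).
Proof.
have [rxi r0] := repr_pathP t; have [] := infty_infinite rxi 0%N.
by rewrite r0.
Qed.

Lemma edge_child t s : e t s -> s <> parent t -> parent s = t.
Proof.
have [eS _ _ _ _] := eT => ts sp; have [rxi r0] := repr_pathP t.
have sxi : xi (fun i => if i is i'.+1 then repr_path xi t i' else s).
  by apply: infty_cons => //; rewrite r0 eS.
by rewrite /parent (repr_path_unique sxi).
Qed.

Lemma ancestors_meet t s : exists m n, iter m parent t = iter n parent s.
Proof.
have [rxi _] := repr_pathP t; have [sxi _] := repr_pathP s.
have [m [n H]] := infty_equiv rxi sxi; exists m, n.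
by have := H 0%N; rewrite !addn0 !repr_pathE.
Qed.

Lemma merge_atE t s m n :
  merge_at xi t s (m, n) <-> iter m parent t = iter n parent s.
Proof.
split=> [/(_ 0%N)|H k]; rewrite /= !repr_pathE ?addn0//.
by rewrite [(m + k)%N]addnC [(n + k)%N]addnC !iterD H.
Qed.

Lemma ancestors_meet_diff t s m n m' n' :
    iter m parent t = iter n parent s -> iter m' parent t = iter n' parent s ->
  (m + n' = m' + n)%N.
Proof.
move=> H H'; apply: (@iter_parent_inj t).
by rewrite addnC [(m' + n)%N]addnC !iterD H H' -!iterD addnC.
Qed.

(** Two meeting indices [(m, n)] and [(m', n')] satisfy [m - n = m' - n'], so a
    pair with least first component also has least second component. *)
Lemma merge_indexP t s :
  merge_at xi t s (merge_index xi t s) /\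
  forall mn, merge_at xi t s mn ->
    ((merge_index xi t s).1 <= mn.1)%N /\ ((merge_index xi t s).2 <= mn.2)%N.
Proof.
have ex : exists m, `[< exists n, iter m parent t = iter n parent s >].
  by have [m [n H]] := ancestors_meet t s; exists m; apply/asboolP; exists n.
apply: (@xgetPex _ (0%N, 0%N)
  [set mn | merge_at xi t s mn /\ forall mn', merge_at xi t s mn' ->
    (mn.1 <= mn'.1)%N /\ (mn.2 <= mn'.2)%N]).
case: (ex_minnP ex) => m /asboolP[n mn] mmin; exists (m, n).
split=> [|[m' n'] /merge_atE mn' /=]; first exact/merge_atE.
have mm' : (m <= m')%N by apply: mmin; apply/asboolP; exists n'.
by have := ancestors_meet_diff mn mn'; lia.
Qed.

Lemma merge_index_iter t s :
  iter (merge_index xi t s).1 parent t = iter (merge_index xi t s).2 parent s.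
Proof.
by apply/merge_atE; case: (merge_indexP t s); case: (merge_index xi t s).
Qed.

Lemma dist_ancestor s n : dist xi s (iter n parent s) = n.
Proof.
have [] := merge_indexP (iter n parent s) s; rewrite /dist.
case: (merge_index _ _ _) => a b /= /merge_atE H /(_ (0%N, n))[]; first exact/merge_atE.
rewrite /= leqn0 => /eqP a0 _; move: H; rewrite a0 add0n.
by move=> H; rewrite (@iter_parent_inj s n b H).
Qed.

Lemma dist_meet t s :
  dist xi t (meet_node xi s t) = (merge_index xi t s).1 /\
  dist xi s (meet_node xi s t) = (merge_index xi t s).2.
Proof.
by rewrite /meet_node repr_pathE dist_ancestor merge_index_iter dist_ancestor.
Qed.

(** The Busemann function of the boundary point, relative to the base node [o]:
    the signed number of generations from [o] down to [t]. *)
Definition level_from (o t : T) : int :=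
  (merge_index xi o t).2%:Z - (merge_index xi o t).1%:Z.

(** Any two pairs of meeting indices differ by a common summand, so the
    contributions of [o] cancel. *)
Lemma level_fromB o t s m n : iter m parent t = iter n parent s ->
  level_from o t - level_from o s = m%:Z - n%:Z.
Proof.
rewrite /level_from; have := merge_index_iter o t; have := merge_index_iter o s.
case: (merge_index xi o t) => a b; case: (merge_index xi o s) => a' b' /= os ot ts.
have H : iter (b' + m)%N parent t = iter (n + b')%N parent s.
  by rewrite iterD ts -iterD addnC.
have H1 : iter (b + a')%N parent t = iter (a + b')%N parent s.
  by rewrite addnC iterD -ot -iterD addnC iterD os -iterD.
by have := ancestors_meet_diff H H1; lia.
Qed.

Lemma base_node_exists : exists _ : T, True.
Proof. by have [p _ _] := @infty_boundary q T; exists (p 0%N). Qed.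

Definition level : T -> int := level_from (projT1 (cid base_node_exists)).

Lemma levelB t s m n : iter m parent t = iter n parent s ->
  level t - level s = m%:Z - n%:Z.
Proof. exact: level_fromB. Qed.

Lemma prec_level s t : prec xi s t = (level s <= level t).
Proof.
rewrite /prec; have [-> ->] := dist_meet t s.
by have := levelB (merge_index_iter t s); lia.
Qed.

Lemma asymp_level s t : asymp xi s t = (level s == level t).
Proof.
rewrite /asymp; have [-> ->] := dist_meet t s.
by have := levelB (merge_index_iter t s); lia.
Qed.

Lemma alpha_range t s : range (fun i => alpha T i t) s <-> parent s = t.
Proof.
rewrite alphaP; split=> /= [[]|<-].
  rewrite prec_level /dist; have := merge_index_iter s t.
  have := levelB (merge_index_iter s t).
  case: (merge_index _ _ _) => m n /= ml mn ts mn1.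
  have [m1 n0] : m = 1%N /\ n = 0%N by lia.
  by move: mn; rewrite m1 n0.
have ls := @levelB s (parent s) 1%N 0%N erefl.
split; first by rewrite prec_level; lia.
have [_ /(_ (1%N, 0%N))[]] := merge_indexP s (parent s); first exact/merge_atE.
by have := levelB (merge_index_iter s (parent s)); rewrite /dist -/xi /=; lia.
Qed.

Lemma parent_alpha i t : parent (alpha T i t) = t.
Proof. by apply/alpha_range; exists i. Qed.

(** A node has [q.+1] neighbours, all of which but its parent are among its
    [q] images under the primitive shifts; so these images are distinct. *)
Lemma alpha_inj t : injective (fun i => alpha T i t).
Proof.
apply/injectiveP; rewrite /dinjectiveb.
have [_ _ _ _ /(_ t)[N [Nu NS] eN]] := eT.
have tpN : parent t \in N by rewrite -eN edge_parent.
apply: (@leq_size_uniq _ (rem (parent t) N)); first exact: rem_uniq.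
  move=> s; rewrite mem_rem_uniq// inE -eN => /andP[/eqP sp ts].
  have /alpha_range[i _ <-] := edge_child ts sp.
  by apply/mapP; exists i => //; rewrite mem_enum.
by rewrite size_map size_rem// NS -cardE card_ord.
Qed.

Lemma act_rcons t w i : act t (rcons w i) = alpha T i (act t w).
Proof. by rewrite /act -cats1 foldl_cat. Qed.

Lemma iter_parent_act t w : iter (size w) parent (act t w) = t.
Proof.
elim/last_ind: w => //= w i IH.
by rewrite size_rcons iterSr act_rcons parent_alpha.
Qed.

Lemma level_act t w : level (act t w) = level t + (size w)%:Z.
Proof. by have := @levelB (act t w) t (size w) 0%N (iter_parent_act t w); lia. Qed.

(** The letters of the word can be read off from its end, since a node
    determines its parent and the primitive shifts have distinct values at the
    parent. *)
Lemma act_inj2 t s w v : size w = size v -> act t w = act s v -> t = s /\ w = v.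
Proof.
move=> wv; elim/last_ind: w v wv => [|w i IH] v.
  by move/esym/size0nil => ->.
elim/last_ind: v => [|v j _]; rewrite !size_rcons// => -[wv].
rewrite !act_rcons => E; have := congr1 parent E; rewrite !parent_alpha => E'.
have [-> <-] := IH _ wv E'; move: E; rewrite -E' => /alpha_inj <-.
by [].
Qed.

Lemma act_inj w : injective (fun t => act t w).
Proof. by move=> t s /act_inj2[]. Qed.

Lemma act_surj s n : exists t (w : n.-tuple 'I_q), s = act t w.
Proof.
elim: n s => [|n IH] s; first by exists s, [tuple].
have [t [w E]] := IH (parent s).
have /alpha_range[i _ <-] := E; exists t.
by exists [tuple of rcons w i]; rewrite act_rcons.
Qed.
End Horocycles.

(** * Bounded operators on square-summable functions *)

Local Notation normc := ComplexField.Normc.normc.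

Section Operators.
Context {R : realType} {T : choiceType}.
Local Notation C := (R[i]).
Implicit Types (f g : ell2 R T) (F G : bop R T) (t s : T).

Lemma esum_fibers (I : choiceType) (h : T -> I) (a : T -> \bar R) :
    (forall t, 0 <= a t)%E ->
  \esum_(t in [set: T]) a t =
  \esum_(i in [set: I]) \esum_(t in [set t | h t = i]) a t.
Proof.
move=> a0; rewrite esum_esum => [|i t _ _]; last exact: a0.
apply: (@reindex_esum _ _ _ _ _ (fun z : I * T => z.2) a); split.
- by move=> [i t].
- by move=> [i t] [j s] /[!inE] -[_ /= <-] [_ /= <-] /= ->.
- by move=> t _; exists (h t, t).
Qed.

Lemma le_esum_inj (h : T -> T) (a : T -> \bar R) : injective h ->
    (forall t, 0 <= a t)%E ->
  (\esum_(t in [set: T]) a (h t) <= \esum_(t in [set: T]) a t)%E.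
Proof.
move=> hI a0; rewrite -(esum_image setT h); last by move=> x y _ _ /hI.
by rewrite esum_mkcond; apply: le_esum => t _; case: ifP.
Qed.

Lemma sqnormc_ge0 (z : C) : (0 <= (normc z ^+ 2)%:E :> \bar R)%E.
Proof. by rewrite lee_fin sqr_ge0. Qed.

Lemma ell2_ext f g : (forall t, f t = g t) -> f = g.
Proof. by move=> fg; apply/val_inj/funext. Qed.

Lemma bop_ext F G : (forall f t, F f t = G f t) -> F = G.
Proof. by move=> FG; apply/val_inj/funext => f; apply: ell2_ext => t; exact: FG. Qed.

Lemma bop_linear_at F (k : C) f g t : F (k *: f + g) t = k * F f t + F g t.
Proof. by rewrite bop_linear. Qed.

Lemma bop0 F : F 0 = 0.
Proof.
by have := bop_linear F (-1) 0 0; rewrite !scaleN1r oppr0 addr0 addNr.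
Qed.

Lemma bopB F f g : F (f - g) = F f - F g.
Proof. by rewrite addrC -scaleN1r bop_linear scaleN1r addrC. Qed.

Lemma bop_sqnorm_bound F : exists2 M : R, 0 <= M &
  forall f, (ell2_sqnorm (F f) <= M%:E * ell2_sqnorm f)%E.
Proof.
have /asboolP[_ /bop_bound_pos[M M0 FM]] := valP F.
exists (M ^+ 2); first exact: sqr_ge0.
move=> f; rewrite -(fineK (ell2_fin_num (F f))) -(fineK (ell2_fin_num f)).
rewrite -EFinM lee_fin -!ell2_norm_sqr -exprMn.
by rewrite lerXn2r// ?nnegrE ?mulr_ge0 ?ell2_norm_ge0//; exact: FM.
Qed.

(** Restrictions, diagonals, compositions and their adjoints are all given by
    pointwise formulas, for which only linearity and a square-norm bound remain
    to be checked. *)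
Lemma bop_intro (phi : ell2 R T -> T -> C^o) :
    (forall (k : C) f g t, phi (k *: f + g) t = k * phi f t + phi g t) ->
    (exists2 M : R, 0 <= M &
       forall f, (ell2_sqnorm (phi f) <= M%:E * ell2_sqnorm f)%E) ->
  exists F : bop R T, forall f t, F f t = phi f t.
Proof.
move=> philin [M M0 phiM].
have phi2 f : phi f \in ell2_pred R T.
  rewrite /in_mem /= /ell2_pred; apply: le_lt_trans (phiM f) _.
  by rewrite -(fineK (ell2_fin_num f)) -EFinM ltry.
have Fop : (fun f => Ell2 (phi2 f)) \in bop_pred R T.
  apply/asboolP; split=> [k f g|]; first by apply: ell2_ext => t; exact: philin.
  exists (Num.sqrt M) => f; rewrite -[X in X * _]ger0_norm ?sqrtr_ge0//.
  rewrite /ell2_norm ger0_norm ?sqrtr_ge0// -sqrtrM// ler_wsqrtr//.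
  rewrite -lee_fin EFinM !fineK ?ell2_fin_num//; exact: phiM.
by exists (Bop Fop).
Qed.

Lemma le_ell2_sqnorm (f g : T -> C^o) :
    (forall t, f t = g t \/ f t = 0) -> (ell2_sqnorm f <= ell2_sqnorm g)%E.
Proof.
move=> fg; apply: le_esum => t _; case: (fg t) => -> //.
by rewrite (ComplexField.Normc.normc0 R) expr0n sqnormc_ge0.
Qed.

Lemma restr_exists (P : pred T) :
  exists F : bop R T, forall f t, F f t = if P t then f t else 0.
Proof.
apply: bop_intro => [k f g t|]; first by case: ifP; rewrite ?mulr0 ?addr0.
exists 1 => // f; rewrite mul1e; apply: le_ell2_sqnorm => t.
by case: ifP; [left|right].
Qed.
Definition restr P : bop R T := projT1 (cid (restr_exists P)).

Lemma restrE P f t : restr P f t = if P t then f t else 0.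
Proof. exact: (projT2 (cid (restr_exists P))). Qed.

Lemma ell2_sqnorm_restr P f :
  ell2_sqnorm (restr P f) = \esum_(t in [set t | P t]) (normc (f t) ^+ 2)%:E.
Proof.
rewrite esum_mkcond; apply: eq_esum => t _; rewrite restrE.
rewrite (_ : (t \in [set t | P t]) = P t); last by apply/idP/idP; rewrite inE.
by case: ifP => // _; rewrite (ComplexField.Normc.normc0 R) expr0n.
Qed.

(** The fibers of [a] cut the input into orthogonal pieces and the fibers of
    [b] keep of the image of each piece one part, these parts being again
    orthogonal; so cutting does not increase the bound of [F]. *)
Lemma blockdiag_exists (I : choiceType) (a b : T -> I) F :
  exists G : bop R T, forall f s, G f s = F (restr (fun t => a t == b s) f) s.
Proof.
apply: bop_intro => [k f g s|]; first by rewrite bop_linear bop_linear_at.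
have [M M0 FM] := bop_sqnorm_bound F; exists M => // f.
rewrite {1}/ell2_sqnorm (esum_fibers b) => [|t]; last exact: sqnormc_ge0.
(* A scalar with squared modulus [M] carries the bound inside the sums. *)
pose k : C := (Num.sqrt M)%:C%C.
have kM : normc k ^+ 2 = M.
  by rewrite /k /= expr0n addr0 sqrtr_sqr ger0_norm ?sqrtr_ge0// sqr_sqrtr.
rewrite -kM -(ell2_sqnormZ k f) /ell2_sqnorm [leRHS](esum_fibers a) => [|t];
  last exact: sqnormc_ge0.
apply: le_esum => i _.
pose Pi t := a t == i.
have -> : \esum_(t in [set t | a t = i]) (normc ((k *: (f : T -> C^o)) t) ^+ 2)%:E =
    ell2_sqnorm (k *: restr Pi f).
  have -> : [set t | a t = i] = [set t | Pi t].
    by apply/seteqP; split=> t /eqP.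
  rewrite -(ell2_sqnorm_restr Pi (k *: f)); congr ell2_sqnorm.
  apply/funext => t; rewrite restrE.
  rewrite (_ : (k *: restr Pi f) t = k *: (restr Pi f t))// restrE.
  by case: ifP => //; rewrite scaler0.
rewrite (_ : ell2_sqnorm _ = ell2_sqnorm (k *: (restr Pi f : T -> C^o)))//.
rewrite ell2_sqnormZ kM; apply: le_trans (FM _).
rewrite [leRHS](esumID [set s | b s = i]); last by move=> *; exact: sqnormc_ge0.
rewrite setTI; apply: le_trans (leeDl _ _); last first.
  by apply: esum_ge0 => *; exact: sqnormc_ge0.
by rewrite /Pi; apply: le_esum => s /= <-.
Qed.
Definition blockdiag I a b F : bop R T := projT1 (cid (@blockdiag_exists I a b F)).

Lemma blockdiagE I a b F f s :
  @blockdiag I a b F f s = F (restr (fun t => a t == b s) f) s.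
Proof. exact: (projT2 (cid (blockdiag_exists a b F))). Qed.

Lemma comp_exists (h : T -> T) : injective h ->
  exists F : bop R T, forall f t, F f t = f (h t).
Proof.
move=> hI; apply: bop_intro => // ; exists 1 => // f; rewrite mul1e.
exact: (le_esum_inj hI (fun t => sqnormc_ge0 (f t))).
Qed.

(** The adjoint of the composition with [h] extends by zero along [h]. *)
Lemma push_exists (h : T -> T) : injective h ->
  exists2 F : bop R T, forall f t, F f (h t) = f t &
    forall f s, ~ range h s -> F f s = 0.
Proof.
move=> hI.
pose phi f s : C^o :=
  if pselect (range h s) is left hs then f (projT1 (cid2 hs)) else 0.
have phih f t : phi f (h t) = f t.
  rewrite /phi; case: pselect => [hs|[]]; last by exists t.
  by case: cid2 => t' /= _ /hI ->.
have phi0 f s : ~ range h s -> phi f s = 0 by rewrite /phi; case: pselect.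
have [||F FE] := @bop_intro phi.
- move=> k f g s; have [[t _ <-]|hs] := pselect (range h s); first by rewrite !phih.
  by rewrite !phi0// mulr0 addr0.
- exists 1 => // f; rewrite mul1e [leRHS](_ : _ =
    \esum_(t in [set: T]) (normc (phi f (h t)) ^+ 2)%:E); last first.
    by apply: eq_esum => t _; rewrite phih.
  rewrite -(esum_image setT h (fun s => (normc (phi f s) ^+ 2)%:E)); last first.
    by move=> x y _ _ /hI.
  rewrite [leRHS]esum_mkcond; apply: le_esum => s _; case: ifPn => //.
  rewrite notin_setE => hs; rewrite phi0//.
  by rewrite (ComplexField.Normc.normc0 R) expr0n.
- by exists F => [f t|f s hs]; rewrite FE ?phih ?phi0.
Qed.

(** Bounded operators with the same matrix agree on functions of finite support,
    and these approximate every square-summable function because the tails of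
    its square norm are arbitrarily small. *)
Lemma eq_bop_chi F G : (forall t s, F (chi t) s = G (chi t) s) -> F = G.
Proof.
move=> FG; apply: bop_ext => f s; apply/eqP; rewrite -subr_eq0; apply/eqP.
pose N := F - G; have NE h : N h = F h - G h by [].
have N0 t : N (chi t) = 0.
  apply: ell2_ext => u; rewrite NE (_ : F (chi t) = G (chi t)) ?subrr//.
  by apply: ell2_ext => v; exact: FG.
(* Removing finitely many values from the argument does not change [N f]. *)
have Nrestr (r : seq T) : N f = N (restr [pred t | t \notin r] f).
  elim: r => [|t r IH].
    by congr (N _); apply: ell2_ext => t; rewrite restrE /=.
  have [tr|tr] := boolP (t \in r).
    rewrite IH; congr (N _); apply: ell2_ext => u; rewrite !restrE /= inE.
    by case: eqVneq => // ->; rewrite tr.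
  rewrite IH (_ : restr _ f = f t *: chi t + restr [pred u | u \notin t :: r] f).
    by rewrite bop_linear N0 scaler0 add0r.
  apply: ell2_ext => u.
  rewrite [RHS](_ : _ = f t * (u == t)%:R + restr [pred u | u \notin t :: r] f u)//.
  rewrite !restrE /= inE; case: eqVneq => [->|_]; rewrite ?tr /= ?mulr1 ?addr0//.
  by rewrite mulr0 add0r.
have [M M0 NM] := bop_sqnorm_bound N.
have H (eps : R) : 0 < eps -> normc (N f s) ^+ 2 <= M * eps.
  move=> eps0.
  have : (ell2_sqnorm f - eps%:E < ell2_sqnorm f)%E.
    by rewrite lteBlDr// lteDl ?ell2_fin_num// lte_fin.
  rewrite {2}/ell2_sqnorm => /ereal_sup_gt[_ [A [finA _] <-]] Af.
  rewrite -lee_fin [leRHS]EFinM (Nrestr (finmap.enum_fset (fset_set A))).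
  set g := restr _ f.
  have geps : (ell2_sqnorm g <= eps%:E)%E.

    have fE : ell2_sqnorm f =
        (\sum_(t \in A) (normc (f t) ^+ 2)%:E + ell2_sqnorm g)%E.
      rewrite {1}/ell2_sqnorm (esumID A) => [|t _]; last exact: sqnormc_ge0.
      rewrite !setTI esum_fset// => [|t _]; last exact: sqnormc_ge0.
      rewrite ell2_sqnorm_restr; congr (_ + \esum_(_ in _) _)%E.
      by apply/seteqP; split=> t /=; rewrite in_fset_set// notin_setE.
    have Afin : (\sum_(t \in A) (normc (f t) ^+ 2)%:E \is a fin_num)%E.
      by rewrite fsbig_finite//= sumEFin.
    by move: Af; rewrite fE lteBlDr// lteD2lE// => /ltW.
 apply: (@le_trans _ _ (ell2_sqnorm (N g))).
    apply: esum_ge; exists [set s]; first by split.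
    by rewrite fsbig_set1.
  by apply: le_trans (NM g) _; rewrite lee_wpmul2l ?lee_fin.
have : normc (N f s) ^+ 2 <= 0.
  rewrite leNgt; apply/negP => x0.
  have M1 : 0 < M + 1 by rewrite ltr_wpDl.
  have := H _ (divr_gt0 x0 M1); rewrite leNgt => /negP; apply.
  by rewrite mulrA ltr_pdivrMr// mulrC ltr_pM2l// ltrDl.
rewrite le_eqVlt ltNge sqr_ge0 orbF sqrf_eq0 => /eqP.
exact: ComplexField.Normc.eq0_normc.
Qed.

Lemma partial_sumE (x : T -> C) (A : {fset T}) :
  summability.partial_sum (x : T -> C^o) A = \sum_(t <- A) x t.
Proof. by rewrite big_seq_fsetE. Qed.

Lemma csum_finite_support (x : T -> C) (s : T) :
  (forall t, t != s -> x t = 0) -> csum x = x s.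
Proof.
move=> xs.
apply: (@lim_near_cst C^o (@norm_hausdorff _ _) _ _
  (@summability.totally_filter T)).
exists [fset s]%fset => //= A /=; rewrite fsub1set => sA.
by rewrite partial_sumE (bigD1_seq s)//= big1 ?addr0.
Qed.

(** Both nets of partial sums run through the same values cofinally: a finite
    set of indices of one family is matched with its image, respectively its
    preimage, under [h]. *)
Lemma csum_extend_by_zero (h : T -> T) (x y : T -> C) : injective h ->
    (forall t, y (h t) = x t) -> (forall s, ~ range h s -> y s = 0) ->
  csum y = csum x.
Proof.
move=> hI yh y0.
suff H : fmap (summability.partial_sum (y : T -> C^o)) summability.totally =
    fmap (summability.partial_sum (x : T -> C^o)) summability.totally.
  exact: (congr1 (fun F : set_system C^o => lim F) H).
have sumE (A B : {fset T}) : (forall t, (t \in A) = (h t \in B)) ->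
    summability.partial_sum (y : T -> C^o) B =
    summability.partial_sum (x : T -> C^o) A.
  move=> AB; rewrite !partial_sumE -(@big_fset_incl _ _ _ _ (h @` A)%fset).
  - by rewrite big_imfset /=; [apply: eq_bigr => t _|move=> ? ? _ _ /hI].
  - by apply/fsubsetP => _ /imfsetP[t /= tA ->]; rewrite -AB.
  - move=> s sB shA; apply: y0 => -[t _ hts].
    by move/negP: shA; apply; rewrite -hts in_imfset//= AB hts.
pose pre (B : {fset T}) := fset_set (h @^-1` [set` B]).
have preE B t : (t \in pre B) = (h t \in B).
  rewrite in_fset_set; first by apply/idP/idP => [/set_mem//|htB]; exact/mem_set.
  by apply: finite_preimage; [move=> ? ? _ _ /hI|exact: finite_fset].
apply/seteqP; split=> P [/= A0 _ A0P].
- exists (pre A0) => // A /= /fsubsetP A0A.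
  rewrite -(sumE A ((h @` A) `|` A0)%fset); first by apply: A0P; exact: fsubsetUr.
  move=> t; rewrite in_fsetU (mem_imfset _ _ hI) /=.
  by apply/idP/orP => [->|[//|htA0]]; [left|apply: A0A; rewrite preE].
- exists (h @` A0)%fset => // B /= /fsubsetP A0B.
  rewrite (sumE (pre B) B (preE B)); apply: A0P => /=.
  by apply/fsubsetP => t tA0; rewrite preE; apply: A0B; rewrite in_imfset.
Qed.

Lemma dotp_chi s g : dotp (chi s) g = (g s)^*%C.
Proof.
rewrite /dotp (@csum_finite_support _ s) /= ?eqxx ?mul1r// => t ts.
by rewrite (negPf ts) mul0r.
Qed.

Lemma badj_unique F G : (forall f g, dotp (F f) g = dotp f (G g)) -> badj F = G.
Proof.
move=> FG; have H : [set G : bop R T | forall f g, dotp (F f) g = dotp f (G g)] G by [].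
have /= GF := @xgetPex _ 0 _ (ex_intro _ G H).
apply: bop_ext => f t; apply: (inv_inj (@conjcK R)).
by rewrite -!dotp_chi -FG -GF.
Qed.

Lemma badj_comp (h : T -> T) F G : injective h ->
    (forall f t, F f t = f (h t)) ->
    (forall f t, G f (h t) = f t) -> (forall f s, ~ range h s -> G f s = 0) ->
  badj F = G.
Proof.
move=> hI FE GE G0; apply: badj_unique => f g.
apply/esym/(csum_extend_by_zero hI) => [t|s hs]; first by rewrite FE GE.
by rewrite G0// conjc0 mulr0.
Qed.
End Operators.

(** * Shifts and diagonals of an operator on the tree *)

Section TreeOps.
Context {R : realType} {q : nat} {T : shiftTree q}.
Implicit Types (F G S U : bop R T) (f g : ell2 R T) (s t : T) (w v : seq 'I_q).

Lemma shift_opE w f t : shift_op w f t = f (act t w).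
Proof.
have [F FE] := comp_exists (R := R) (@act_inj q T w).
exact: (@xgetPex _ 0 [set W : bop R T | forall f t, W f t = f (act t w)]
  (ex_intro _ F FE)).
Qed.

Lemma shift_op_nil : shift_op [::] = 1 :> bop R T.
Proof. by apply: bop_ext => f t; rewrite shift_opE. Qed.

Lemma shift_op_rcons w i :
  shift_op (rcons w i) = shift_op w * shift_op [:: i] :> bop R T.
Proof.
apply: bop_ext => f t; rewrite [RHS](_ : _ = shift_op w (shift_op [:: i] f) t)//.
by rewrite !shift_opE act_rcons.
Qed.

Lemma badj_shift_op w f :
  (forall t, badj (shift_op w) f (act t w) = f t) /\
  (forall s, ~ range (fun t => act t w) s -> badj (shift_op w) f s = 0).
Proof.
have [G GE G0] := push_exists (R := R) (@act_inj q T w).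
by rewrite (badj_comp (@act_inj q T w) (@shift_opE w) GE G0); split=> [t|s /G0].
Qed.

Lemma shift_opK w : shift_op w * badj (shift_op w) = 1 :> bop R T.
Proof.
apply: bop_ext => f t.
rewrite [LHS](_ : _ = shift_op w (badj (shift_op w) f) t)// shift_opE.
by have [-> _] := badj_shift_op w f.
Qed.

Lemma bop_sumE (I : finType) (F : I -> bop R T) f t :
  (\sum_i F i) f t = \sum_i F i f t.
Proof. by elim/big_rec2: _ => // i y1 y2 _ <-. Qed.

(** Every node has exactly one ancestor at distance [n], so that the ranges of
    the isometries [v^*] with [|v| = n] decompose the space. *)
Lemma sum_badj_shift_op n :
  \sum_(v : n.-tuple 'I_q) badj (shift_op v) * shift_op v = 1 :> bop R T.
Proof.
apply: bop_ext => f s; rewrite bop_sumE; have [t [w ->]] := act_surj s n.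
rewrite (bigD1 w)// big1 => [|v /andP[_ vw]].
  rewrite [LHS](_ : _ = badj (shift_op w) (shift_op w f) (act t w)); last exact: addr0.
  by have [-> _] := badj_shift_op w (shift_op w f); rewrite shift_opE.
rewrite [LHS](_ : _ = badj (shift_op v) (shift_op v f) (act t w))//.
have [_ ->//] := badj_shift_op v (shift_op v f).
move=> [t' _ /act_inj2[|_ /val_inj vw']]; first by rewrite !size_tuple.
by rewrite vw' eqxx in vw.
Qed.

(** The component of [F] that moves every node down by exactly [n] levels. *)
Definition diag n F : bop R T :=
  blockdiag (fun t => level t + n%:Z) (@level q T) F.

Lemma diagE n F f s :
  diag n F f s = F (restr (fun t => level t + n%:Z == level s) f) s.
Proof. exact: blockdiagE. Qed.

Lemma diagD n F G : diag n (F + G) = diag n F + diag n G.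
Proof.
apply: bop_ext => f s; rewrite diagE.
by rewrite [RHS](_ : _ = diag n F f s + diag n G f s)// !diagE.
Qed.

Lemma diagB n F G : diag n (F - G) = diag n F - diag n G.
Proof.
apply: bop_ext => f s; rewrite diagE.
by rewrite [RHS](_ : _ = diag n F f s - diag n G f s)// !diagE.
Qed.

Lemma diag_sum (I : finType) n (F : I -> bop R T) :
  diag n (\sum_i F i) = \sum_i diag n (F i).
Proof.
apply: bop_ext => f s; rewrite diagE !bop_sumE.
by apply: eq_bigr => i _; rewrite diagE.
Qed.

Lemma diag_diag n k F : diag n (diag k F) = if n == k then diag k F else 0.
Proof.
apply: bop_ext => f s; rewrite !diagE; case: eqVneq => [->|nk].
  rewrite diagE; congr (F _ _); apply: ell2_ext => t; rewrite !restrE.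
  by case: eqP.
rewrite (_ : restr _ _ = 0) ?bop0//; apply: ell2_ext => t; rewrite !restrE.
by case: eqP => // E; case: eqP => // E'; lia.
Qed.

(** [truncate n F] is the sum of the terms [w^* F_[w]] with [|w| < n]. *)
Definition truncate n F : bop R T := \sum_(k < n) diag k F.

Lemma truncateS n F : truncate n.+1 F = truncate n F + diag n F.
Proof. exact: big_ord_recr. Qed.

Lemma diag_truncate n F : diag n (truncate n F) = 0.
Proof.
rewrite diag_sum big1// => k _; rewrite diag_diag; case: eqP => // nk.
by have := ltn_ord k; rewrite -nk ltnn.
Qed.

Lemma restr_chi (P : pred T) t : restr P (chi t) = if P t then chi t else 0 :> ell2 R T.
Proof.
apply: ell2_ext => s; rewrite restrE.
have [->|st] := eqVneq s t; first by case: ifP.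
rewrite [LHS](_ : _ = 0); first by case: ifP => //= _; rewrite (negPf st).
by case: ifP => //= _; rewrite (negPf st).
Qed.

(** The right-hand side has the matrix that characterizes the coefficient,
    because the ancestor [s] of [act s w] is on level [level (act s w) - |w|];
    this also shows that every bounded operator has bounded coefficients. *)
Lemma coef_diag F w : coef F w = shift_op w * diag (size w) F.
Proof.
pose P := [set K : bop R T | forall t s : T,
    K (chi t) s = if asymp (infty T) t s then F (chi t) (act s w) else 0].
have PF : P (shift_op w * diag (size w) F).
  move=> t s; rewrite [LHS](_ : _ = shift_op w (diag (size w) F (chi t)) s)//.
  rewrite shift_opE diagE restr_chi level_act asymp_level.
  by rewrite (inj_eq (addIr _)); case: ifP => // _; rewrite bop0.
have PC : P (coef F w) by apply: (@xgetPex _ 0); exists (shift_op w * diag (size w) F).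
by apply: eq_bop_chi => t s; rewrite PC PF.
Qed.

Lemma eval0_diag F : eval0 F = diag 0 F.
Proof. by rewrite /eval0 coef_diag shift_op_nil mul1r. Qed.

(** [w] sends a function on level [l] to one on level [l - |w|]. *)
Lemma diag0_shift_op G w :
  diag 0 (G * shift_op w) = diag (size w) G * shift_op w.
Proof.
apply: bop_ext => f s; rewrite diagE.
rewrite [RHS](_ : _ = diag (size w) G (shift_op w f) s)// diagE.
rewrite [LHS](_ : _ = G (shift_op w (restr (fun t => level t + 0 == level s) f)) s)//.
congr (G _ _); apply: ell2_ext => t.
by rewrite shift_opE !restrE shift_opE level_act addr0.
Qed.

(** [(diag n U) w] with [n = |w|] preserves each level: [w] moves the support up
    by [n] levels and the [n]-th diagonal moves it back down.  So it can be
    taken out of a main diagonal. *)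
Lemma diag0_mul F U w :
  diag 0 (F * (diag (size w) U * shift_op w)) =
  diag 0 F * (diag (size w) U * shift_op w).
Proof.
apply: bop_ext => f s; rewrite diagE.
pose V := diag (size w) U * shift_op w.
rewrite [LHS](_ : _ = F (V (restr (fun t => level t + 0 == level s) f)) s)//.
rewrite [RHS](_ : _ = diag 0 F (V f) s)// diagE.
congr (F _ _); apply: ell2_ext => t; rewrite restrE.
have VE g : V g t = diag (size w) U (shift_op w g) t by [].
rewrite !VE !diagE; case: eqP => ts.
  congr (U _ _); apply: ell2_ext => u; rewrite !restrE !shift_opE restrE.
  by case: eqP => // ut; case: eqP => // us; case: us; rewrite level_act ut -ts.
rewrite (_ : restr _ _ = 0) ?bop0//; apply: ell2_ext => u; rewrite !restrE.
case: eqP => // ut; rewrite shift_opE restrE; case: eqP => // us.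
by case: ts; move: us; rewrite level_act; lia.
Qed.

Lemma causal_level F s f : causal F ->
  (forall t, level t <= level s -> f t = 0) -> F f s = 0.
Proof.
move=> Fc f0; apply: (Fc s) => [t|]; last by rewrite prec_level.
by rewrite prec_level => /f0.
Qed.

(** On a function supported on level [l], the truncation of [U] gives the same
    values as [U] on all levels up to [l + n]; what [U] gives further down
    cannot be brought back up to level [l + n] by a causal multiplier. *)
Lemma diag_mul_truncate n S U : causal S -> causal U ->
  diag n (S * truncate n.+1 U) = diag n (S * U).
Proof.
move=> Sc Uc; apply: bop_ext => f s; rewrite !diagE.
set V := truncate _ _; set g := restr _ f.
rewrite [LHS](_ : _ = S (V g) s)// [RHS](_ : _ = S (U g) s)//.
apply/eqP; rewrite -subr_eq0; apply/eqP.
rewrite [LHS](_ : _ = S (V g - U g) s); last by rewrite bopB.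
apply: causal_level => // t ts.
rewrite [LHS](_ : _ = V g t - U g t)//; apply/eqP; rewrite subr_eq0; apply/eqP.
have gE u : level u + n%:Z != level s -> g u = 0.
  by rewrite /g restrE => /negPf ->.
rewrite /V /truncate bop_sumE; have [lt|lt] := lerP (level s) (level t + n%:Z).
  pose m := absz (level t + n%:Z - level s)%R.
  have mn : (m < n.+1)%N by rewrite /m; lia.
  (* [g] lives on the single level [level s - n], so only one term survives. *)
  rewrite (bigD1 (Ordinal mn))//= big1 => [|k km].
    rewrite addr0 diagE; congr (U _ _); apply: ell2_ext => u; rewrite restrE.
    by case: eqP => // ut; rewrite gE//; apply/eqP; rewrite /m in ut *; lia.
  rewrite diagE (_ : restr _ _ = 0) ?bop0//; apply: ell2_ext => u.
  rewrite restrE; case: eqP => // ut; rewrite gE//.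
  by apply: contra km => /eqP us; apply/eqP/val_inj => /=; rewrite /m; lia.
have Ug : U g t = 0.
  by apply: causal_level => // u ut; rewrite gE//; apply/eqP; lia.
rewrite Ug big1// => k _; rewrite diagE (_ : restr _ _ = 0) ?bop0//.
apply: ell2_ext => u; rewrite restrE; case: eqP => // ut; rewrite gE//.
by apply/eqP; lia.
Qed.
End TreeOps.

(** * The state-space recursion *)

Section StateEvolution.
Context {R : realType} {q : nat} {T : shiftTree q}.
Implicit Types (F U Y : bop R T) (w v : seq 'I_q).

Lemma sum_shifted_coef n U w :
  \sum_(v : n.-tuple 'I_q) badj (shift_op v) * coef U v * shift_op w =
  diag n U * shift_op w.
Proof.
rewrite -[diag n U]mul1r -(sum_badj_shift_op n) !mulr_suml.
by apply: eq_bigr => v _; rewrite coef_diag size_tuple !mulrA.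
Qed.

(** The state to be read at step [n], input included, has the [n]-th diagonal of
    the output as its [n]-th diagonal. *)
Lemma diag_state n S U : causal S -> causal U ->
  diag n (S * truncate n.+1 U - truncate n (S * U)) = diag n (S * U).
Proof. by move=> Sc Uc; rewrite diagB diag_truncate subr0 diag_mul_truncate. Qed.
End StateEvolution.

Theorem theorem6p9 (R : realType) (q : nat) (q_gt0 : (0 < q)%N)
  (T : shiftTree q)
  (S : bop R T) (S_schur : schur_multiplier S)
  (A : 'I_q -> HS S -> HS S) (B : 'I_q -> C2 R T -> HS S)
  (C : HS S -> C2 R T) (D : C2 R T -> C2 R T)
  (AE : forall j F, val (A j F) = (val F - eval0 (val F)) * shift_op [:: j])
  (BE : forall j d, val (B j d) = (S - eval0 S) * val d * shift_op [:: j])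
  (CE : forall F, val (C F) = eval0 (val F))
  (DE : forall d, val (D d) = eval0 S * val d)
  (V_bounded : forall j, bounded_block (A j) (B j) C D)
  (U Y : H2 R T) (YE : val Y = S * val U)
  (U_ : seq 'I_q -> C2 R T)
  (U_E : forall w, val (U_ w) =
     \sum_(v : (size w).-tuple 'I_q) badj (shift_op v) * coef (val U) v * shift_op w)
  (X : seq 'I_q -> HS S)
  (X_nil : val (X [::]) = 0)
  (X_rcons : forall w j,
     val (X (rcons w j)) = val (A j (X w)) + val (B j (U_ w))) :
  forall w v : seq 'I_q, size v = size w ->
    coef (val Y) w = shift_op w * (val (C (X v)) + val (D (U_ v))) * badj (shift_op v).
Proof.
have [Sc _] := S_schur; have [Uc _] : H2 R T (val U) := set_valP U.
have UwE w : val (U_ w) = diag (size w) (val U) * shift_op w.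
  by rewrite U_E sum_shifted_coef.
(* [Z n] is the state after the input of step [n] has been read and before the
   output of step [n] has been removed, with the final shift stripped. *)
pose Z n := S * truncate n.+1 (val U) - truncate n (val Y).
have ZE w : val (X w) = (S * truncate (size w) (val U) - truncate (size w) (val Y)) * shift_op w ->
    val (X w) + S * val (U_ w) = Z (size w) * shift_op w.
  move=> ->; rewrite UwE mulrA -mulrDl; congr (_ * _).
  by rewrite /Z truncateS mulrDr addrAC.
have out w : val (X w) + S * val (U_ w) = Z (size w) * shift_op w ->
    eval0 (val (X w)) + eval0 S * val (U_ w) = diag (size w) (val Y) * shift_op w.
  move=> ZwE; rewrite !eval0_diag UwE -diag0_mul -diagD -UwE ZwE diag0_shift_op.
  by rewrite /Z YE diag_state.
have XE w : val (X w) =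
    (S * truncate (size w) (val U) - truncate (size w) (val Y)) * shift_op w.
  elim/last_ind: w => [|w j IH].
    by rewrite X_nil /truncate !big_ord0 mulr0 subr0 mul0r.
  have ZwE := ZE _ IH.
  rewrite X_rcons AE BE -mulrDl mulrBl addrACA -opprD ZwE (out _ ZwE).
  rewrite -mulrBl -mulrA -shift_op_rcons size_rcons; congr (_ * _).
  by rewrite /Z (truncateS _ (val Y)) opprD addrA.
move=> w v vw; rewrite CE DE (out _ (ZE _ (XE v))) coef_diag vw.
by rewrite -!mulrA shift_opK mulr1.
Qed.
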